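(* Let $m\ge 27$ be an integer and let $p,l,q$ be positive integers with $p\le 27\sqrt{m}+\frac{16\sqrt{m}}{\log^{3} m}$, $l\le 27\sqrt{m}$ and $q\le 2^{106\frac{\sqrt{m}}{\log m}}$. Let $G_1=K_p$ and $G_2=K_l+qK_1$. Then $R(G_1,G_2)\le 2^{250\sqrt{m}}$.
   Context: Graphs are finite and simple. For graphs $G_1,G_2$, the Ramsey number $R(G_1,G_2)$ is the smallest positive integer $N$ such that every blue-red edge coloring of the complete graph $K_N$ contains a blue subgraph isomorphic to $G_1$ or a red subgraph isomorphic to $G_2$. The join $G+H$ of two graphs $G$ and $H$ (on disjoint vertex sets) is the graph with vertex set $V(G)\cup V(H)$ and edge set $E(G)\cup E(H)\cup\{uv : u\in V(G), v\in V(H)\}$. $K_r$ is the complete graph on $r$ vertices, and $qK_1$ is the edgeless graph on $q$ vertices; $K_l+qK_1$ is the join of $K_l$ and $qK_1$. $\log$ denotes the logarithm in base $2$, and $\log^3 m=(\log m)^3$. *)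

(* Defs.v *)
From mathcomp Require Import all_boot all_order all_algebra.
From mathcomp Require Import reals exp.

Set Implicit Arguments.
Unset Strict Implicit.
Unset Printing Implicit Defensive.

Import Order.TTheory GRing.Theory Num.Theory.

Local Open Scope set_scope.
Local Open Scope nat_scope.

Record sgraph : Type := SGraph {
  vertex :> finType;
  adj : rel vertex;
  adj_sym : symmetric adj;
  adj_irrefl : irreflexive adj }.

Definition complete_adj (r : nat) : rel 'I_r := fun x y => x != y.
Lemma complete_sym r : symmetric (@complete_adj r).
Proof. by move=> x y; rewrite /complete_adj eq_sym. Qed.
Lemma complete_irrefl r : irreflexive (@complete_adj r).
Proof. by move=> x; rewrite /complete_adj eqxx. Qed.
Definition complete_graph (r : nat) : sgraph :=
  SGraph (@complete_sym r) (@complete_irrefl r).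

Definition edgeless_adj (q : nat) : rel 'I_q := fun _ _ => false.
Lemma edgeless_sym q : symmetric (@edgeless_adj q). Proof. by []. Qed.
Lemma edgeless_irrefl q : irreflexive (@edgeless_adj q). Proof. by []. Qed.
Definition edgeless_graph (q : nat) : sgraph :=
  SGraph (@edgeless_sym q) (@edgeless_irrefl q).

Definition join_adj (G H : sgraph) : rel (vertex G + vertex H)%type :=
  fun u v =>
    match u, v with
    | inl x, inl y => adj x y
    | inr x, inr y => adj x y
    | _, _ => true
    end.
Lemma join_sym G H : symmetric (@join_adj G H).
Proof. by case=> x [] y //=; rewrite adj_sym. Qed.
Lemma join_irrefl G H : irreflexive (@join_adj G H).
Proof. by case=> x /=; rewrite adj_irrefl. Qed.
Definition join_graph (G H : sgraph) : sgraph :=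
  SGraph (@join_sym G H) (@join_irrefl G H).

(* An edge {x, y} of K_N is the two-element set [set x; y]. A colouring is
   total on {set 'I_N}, but only its values on two-element sets matter. *)
Definition coloring (N : nat) := {ffun {set 'I_N} -> bool}.
Definition blue := true.
Definition red := false.

Definition has_mono_copy (G : sgraph) N (c : coloring N) (col : bool) : bool :=
  [exists f : {ffun G -> 'I_N}, injectiveb f &&
    [forall x, forall y, adj x y ==> (c [set f x; f y] == col)]].

Definition ramsey_prop (G1 G2 : sgraph) (N : nat) : bool :=
  (0 < N) &&
  [forall c : coloring N, has_mono_copy G1 c blue || has_mono_copy G2 c red].

Definition mono_clique N (c : coloring N) (col : bool) (B : {set 'I_N}) : Prop :=
  {in B &, forall x y, x != y -> c [set x; y] = col}.

Lemma mono_clique_exists N (c : coloring N) s t (A : {set 'I_N}) :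
  2 ^ (s + t) <= #|A| ->
  (exists2 B : {set 'I_N}, B \subset A /\ #|B| = s & mono_clique c blue B) \/
  (exists2 B : {set 'I_N}, B \subset A /\ #|B| = t & mono_clique c red B).
Proof.
have clique0 col : mono_clique c col set0 by move=> x y; rewrite inE.
have cliqueU1 col x (B : {set 'I_N}) : mono_clique c col B ->
    {in B, forall y, c [set x; y] = col} -> mono_clique c col (x |: B).
  move=> hB hx y z /setU1P[->|yB] /setU1P[->|zB].
  - by rewrite eqxx.
  - by move=> _; exact: hx.
  - by move=> _; rewrite setUC; exact: hx.
  - exact: hB.
have [n] := ubnP (s + t); elim: n => // n IHn in s t A *.
case: s => [_ _|s]; first by left; exists set0; rewrite ?sub0set ?cards0.
case: t => [_ _|t]; first by right; exists set0; rewrite ?sub0set ?cards0.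
move=> stn stA.
have [x xA] : exists x, x \in A.
  by apply/set0Pn; rewrite -card_gt0 (leq_trans _ stA) ?expn_gt0.
pose D col := [set y in A :\ x | c [set x; y] == col].
have extend col (B : {set 'I_N}) : B \subset D col -> mono_clique c col B ->
    [/\ x |: B \subset A, #|x |: B| = #|B|.+1 & mono_clique c col (x |: B)].
  move=> /subsetP BD hB; split.
  - apply/subsetP => y /setU1P[->//|/BD]; rewrite !inE.
    by case/andP=> /andP[].
  - rewrite cardsU1; case: (boolP (x \in B)) => // /BD.
    by rewrite !inE eqxx.
  - by apply: cliqueU1 => // y /BD; rewrite inE => /andP[_ /eqP].
have DA col : D col \subset A.
  by apply/subsetP => y; rewrite !inE => /andP[/andP[]].
have cardA : #|A| = (#|D blue| + #|D red|).+1.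
  rewrite (cardsD1 x) xA add1n; congr _.+1.
  rewrite -(cardsID [set y | c [set x; y]] (A :\ x)).
  congr (_ + _); apply: eq_card => y; rewrite !inE.
    by rewrite eqb_id.
  by rewrite eqbF_neg andbC.
have [bigD|smallD] := leqP (2 ^ (s + t.+1)) #|D blue|.
  case: (IHn s t.+1 (D blue) _ bigD); first by rewrite -ltnS.
    case=> B [BD Bs] /(extend _ _ BD)[h1 h2 h3].
    by left; exists (x |: B); rewrite // h2 Bs.
  by case=> B [BD Bt] hB; right; exists B => //; rewrite (subset_trans BD).
have bigD : 2 ^ (s.+1 + t) <= #|D red|.
  rewrite leqNgt; apply/negP => smallD'; move: stA.
  rewrite cardA leqNgt => /negP; apply.
  rewrite addSn expnS mul2n -addnn -addnS -addSn.
  by apply: leq_add => //; rewrite -addSnnS.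
case: (IHn s.+1 t (D red) _ bigD); first by rewrite -ltnS -addnS.
  by case=> B [BD Bs] hB; left; exists B => //; rewrite (subset_trans BD).
case=> B [BD Bt] /(extend _ _ BD)[h1 h2 h3].
by right; exists (x |: B); rewrite // h2 Bt.
Qed.

Lemma has_mono_copy_clique (G : sgraph) N (c : coloring N) col (B : {set 'I_N}) :
  #|B| = #|G| -> mono_clique c col B -> has_mono_copy G c col.
Proof.
move=> eqB hB; pose e x := @enum_val _ (mem B) (cast_ord (esym eqB) (enum_rank x)).
have e_inj : injective e.
  by move=> x y /enum_val_inj/cast_ord_inj/enum_rank_inj.
apply/existsP; exists (finfun e); apply/andP; split.
  by apply/injectiveP => x y; rewrite !ffunE => /e_inj.
apply/forallP => x; apply/forallP => y; apply/implyP => xy; rewrite !ffunE.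
apply/eqP/hB; try exact: enum_valP.
by apply: contraTneq xy => /e_inj->; rewrite adj_irrefl.
Qed.

Lemma ramsey_exists (G1 G2 : sgraph) : exists N, ramsey_prop G1 G2 N.
Proof.
exists (2 ^ (#|G1| + #|G2|)); rewrite /ramsey_prop expn_gt0 /=.
apply/forallP => c; apply/orP.
have := @mono_clique_exists _ c #|G1| #|G2| setT.
rewrite cardsT card_ord => /(_ (leqnn _)) [] [B [_ cB] hB].
  by left; exact: has_mono_copy_clique hB.
by right; exact: has_mono_copy_clique hB.
Qed.

(* The least N satisfying ramsey_prop, see ex_minnP. *)
Definition ramsey_number (G1 G2 : sgraph) : nat := ex_minn (ramsey_exists G1 G2).

Definition log2 (R : realType) (x : R) : R := (ln x / ln 2)%R.

(* Main.v *)
Require Import Defs.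
From mathcomp Require Import all_boot all_order all_algebra.
From mathcomp Require Import reals exp.
From mathcomp Require Import lra.

Import Order.TTheory GRing.Theory Num.Theory.

Local Open Scope ring_scope.

(** The argument of Erdos and Szekeres already gives far more than the stated
    bound.  Among [2 M] points, any one of them has at least [M] blue or at least
    [M] red neighbours, since the other points number [2 M - 1].  So, in a
    set of [2 ^ (s + t) * q] points, some colour neighbourhood has at least
    [2 ^ (s + t - 1) * q] points, and there one vertex less of the blue clique
    of size [s] or of the red clique of size [t] remains to be found.  When the
    red clique is complete, at least [q] points are left, all joined to it in
    red, and they serve as the edgeless part of the join ([clique_or_book]).
    Hence
    [R(K_p, K_l + q K_1) <= 2 ^ (p + l) * q] ([ramsey_number_book_le]).

    With [x = sqrt m] and [log m >= 1], the hypotheses give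
    [p <= (27 + 16) x], [l <= 27 x] and [q <= 2 ^ (106 x)], and
    [43 + 27 + 106 = 176 <= 250]. *)

(** [B] is the spine and [Q] the set of pages of a book.  The edges inside [Q]
    have arbitrary colours, as a copy of a graph need not be induced. *)
Definition mono_book {N} (c : coloring N) (col : bool) (B Q : {set 'I_N}) : Prop :=
  [/\ [disjoint B & Q], mono_clique c col B
    & {in B & Q, forall x y, c [set x; y] = col}].

Lemma mono_clique0 {N} (c : coloring N) col : mono_clique c col set0.
Proof. by move=> x y; rewrite inE. Qed.

Lemma mono_cliqueU1 {N} (c : coloring N) col x (B : {set 'I_N}) :
  {in B, forall y, c [set x; y] = col} -> mono_clique c col B ->
  mono_clique c col (x |: B).
Proof.
move=> hx hB y z /setU1P[->|yB] /setU1P[->|zB].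
- by rewrite eqxx.
- by move=> _; exact: hx.
- by move=> _; rewrite setUC; exact: hx.
- exact: hB.
Qed.

Lemma mono_bookU1 {N} (c : coloring N) col x (B Q : {set 'I_N}) :
  x \notin Q -> {in B :|: Q, forall y, c [set x; y] = col} ->
  mono_book c col B Q -> mono_book c col (x |: B) Q.
Proof.
move=> xQ hx [dBQ hB hBQ]; split.
- by rewrite -setI_eq0 setIUl setU_eq0 !setI_eq0 disjoints1 xQ.
- by apply: mono_cliqueU1 => // y yB; apply: hx; rewrite inE yB.
- move=> y z /setU1P[->|yB] zQ; last exact: hBQ.
  by apply: hx; rewrite inE zQ orbT.
Qed.

Definition color_nbhd {N} (c : coloring N) (col : bool) (x : 'I_N) (A : {set 'I_N}) :=
  [set y in A :\ x | c [set x; y] == col].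

Lemma color_nbhdP {N} (c : coloring N) col x (A : {set 'I_N}) y :
  y \in color_nbhd c col x A -> [/\ y != x, y \in A & c [set x; y] = col].
Proof. by rewrite !inE => /andP[/andP[-> ->] /eqP]. Qed.

Lemma card_color_nbhd {N} (c : coloring N) x (A : {set 'I_N}) : x \in A ->
  #|A| = (#|color_nbhd c blue x A| + #|color_nbhd c red x A|).+1.
Proof.
move=> xA; rewrite (cardsD1 x) xA add1n; congr _.+1.
rewrite -(cardsID [set y | c [set x; y]] (A :\ x)).
congr addn; apply: eq_card => y; rewrite !inE.
  by rewrite eqb_id.
by rewrite eqbF_neg andbC.
Qed.

(** Erdos-Szekeres with the red induction stopped at a set of [q] points
    instead of a single one; these points are the pages. *)
Lemma clique_or_book {N} (c : coloring N) s t q (A : {set 'I_N}) :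
  (0 < q)%N -> (2 ^ (s + t) * q <= #|A|)%N ->
  (exists B : {set 'I_N}, [/\ B \subset A, #|B| = s & mono_clique c blue B]) \/
  (exists B Q : {set 'I_N},
     [/\ B :|: Q \subset A, #|B| = t, #|Q| = q & mono_book c red B Q]).
Proof.
move=> q0; elim: s t A => [t A _|s IHs].
  by left; exists set0; rewrite sub0set cards0; split=> //; exact: mono_clique0.
elim=> [A|t IHt A leA].
  move=> leA; right.
  have /card_geqP[Q [Quniq Qq QA]] : (q <= #|A|)%N.
    by rewrite (leq_trans _ leA) ?leq_pmull ?expn_gt0.
  exists set0, [set y in Q]; split; rewrite ?cards0 //.
  - by rewrite set0U; apply/subsetP => y; rewrite inE => /QA.
  - by rewrite cardsE (card_uniqP Quniq).
  - split; [by rewrite -setI_eq0 set0I | exact: mono_clique0 |].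
    by move=> y z; rewrite in_set0.
have [x xA] : exists x, x \in A.
  by apply/set0Pn; rewrite -card_gt0 (leq_trans _ leA) ?muln_gt0 ?expn_gt0.
have nbhdA col : color_nbhd c col x A \subset A.
  by apply/subsetP => y /color_nbhdP[].
have cardU1 col (B : {set 'I_N}) :
    B \subset color_nbhd c col x A -> #|x |: B| = #|B|.+1.
  move=> /subsetP BD; rewrite cardsU1; case: (boolP (x \in B)) => // /BD.
  by case/color_nbhdP; rewrite eqxx.
have [leD|ltD] := leqP (2 ^ (s + t.+1) * q) #|color_nbhd c blue x A|.
  case: (IHs _ _ leD) => [[B [BD Bs hB]]|[B [Q [BQD Bt Qq hBQ]]]].
    left; exists (x |: B); split.
    - by rewrite subUset sub1set xA (subset_trans BD).
    - by rewrite (cardU1 blue) ?Bs.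
    - by apply: mono_cliqueU1 => // y /(subsetP BD)/color_nbhdP[].
  by right; exists B, Q; split=> //; exact: subset_trans (nbhdA blue).
(* Two colour neighbourhoods of fewer than M points and the point x itself make
   at most 2 M - 1 points, for M = 2 ^ (s + t + 1) * q. *)
have leD : (2 ^ (s.+1 + t) * q <= #|color_nbhd c red x A|)%N.
  rewrite leqNgt; apply/negP => ltD'; move: leA.
  rewrite (card_color_nbhd c x A xA) leqNgt => /negP; apply.
  rewrite addSn expnS -mulnA mul2n -addnn -addnS -addSn.
  by apply: leq_add => //; rewrite -addSnnS.
case: (IHt _ leD) => [[B [BD Bs hB]]|[B [Q [BQD Bt Qq hBQ]]]].
  by left; exists B; split=> //; exact: subset_trans (nbhdA red).
have [BD QD] : B \subset color_nbhd c red x A /\ Q \subset color_nbhd c red x A.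
  by apply/andP; rewrite -subUset.
right; exists (x |: B), Q; split=> //.
- by rewrite -setUA subUset sub1set xA (subset_trans BQD).
- by rewrite (cardU1 red) ?Bt.
- apply: mono_bookU1 => //; last by move=> y /(subsetP BQD)/color_nbhdP[].
  by apply/negP => /(subsetP QD)/color_nbhdP[]; rewrite eqxx.
Qed.

Lemma injection_into_set (T : finType) (B : {set T}) n : #|B| = n ->
  exists2 e : 'I_n -> T, injective e & forall i, e i \in B.
Proof.
by move=> <-; exists enum_val; [exact: enum_val_inj|exact: enum_valP].
Qed.

Lemma has_mono_copy_book {N} (c : coloring N) col l q (B Q : {set 'I_N}) :
  #|B| = l -> #|Q| = q -> mono_book c col B Q ->
  has_mono_copy (join_graph (complete_graph l) (edgeless_graph q)) c col.
Proof.
move=> /injection_into_set[e e_inj eB] /injection_into_set[f f_inj fQ].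
move=> [dBQ hB hBQ].
have e_neq_f i j : e i != f j.
  by apply: contraTneq (fQ j) => <-; rewrite (disjointFr dBQ).
pose g (u : 'I_l + 'I_q) := match u with inl i => e i | inr j => f j end.
have g_inj : injective g.
  case=> i [] j //= => [/e_inj->//|/eqP|/esym/eqP|/f_inj->//];
  by rewrite (negPf (e_neq_f _ _)).
apply/existsP; exists (finfun g); apply/andP; split.
  by apply/injectiveP => x y; rewrite !ffunE => /g_inj.
apply/forallP => x; apply/forallP => y; apply/implyP; rewrite !ffunE.
case: x y => i [] j //= ij; apply/eqP.
- by apply: hB => //; rewrite (inj_eq e_inj).
- exact: hBQ.
- by rewrite setUC; exact: hBQ.
Qed.

Lemma ramsey_number_book_le p l q : (0 < q)%N ->
  (ramsey_number (complete_graph p)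
     (join_graph (complete_graph l) (edgeless_graph q)) <= 2 ^ (p + l) * q)%N.
Proof.
move=> q0; rewrite /ramsey_number; case: ex_minnP => n _; apply.
rewrite /ramsey_prop muln_gt0 expn_gt0 q0 /=.
apply/forallP => c; apply/orP.
have := clique_or_book c p l q setT q0.
rewrite cardsT card_ord => /(_ (leqnn _)) [[B [_ Bp hB]]|[B [Q [_ Bl Qq hBQ]]]].
  by left; apply: has_mono_copy_clique hB; rewrite Bp card_ord.
by right; exact: has_mono_copy_book hBQ.
Qed.

Lemma log2_ge1 (R : realType) (x : R) : 2 <= x -> 1 <= log2 x.
Proof.
move=> x2; have ln2_gt0 : 0 < ln 2 :> R by rewrite ln_gt0 ?ltr1n.
by rewrite /log2 ler_pdivlMr // mul1r ler_ln // posrE; lra.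
Qed.

Theorem corollary1p8 (R : realType) (m p l q : nat)
    (hm : (27 <= m)%N) (hp0 : (0 < p)%N) (hl0 : (0 < l)%N) (hq0 : (0 < q)%N)
    (hp : p%:R <= 27 * Num.sqrt m%:R
                  + 16 * Num.sqrt m%:R / log2 m%:R ^+ 3 :> R)
    (hl : l%:R <= 27 * Num.sqrt m%:R :> R)
    (hq : q%:R <= 2 `^ (106 * (Num.sqrt m%:R / log2 m%:R)) :> R) :
  (ramsey_number (complete_graph p)
     (join_graph (complete_graph l) (edgeless_graph q)))%:R
    <= 2 `^ (250 * Num.sqrt m%:R) :> R.
Proof.
have L1 : 1 <= log2 (m%:R : R).
  by apply: log2_ge1; rewrite ler_nat (leq_trans _ hm).
have x0 : 0 <= Num.sqrt (m%:R : R) by exact: sqrtr_ge0.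
move: hp hl hq L1 x0.
set x := Num.sqrt _; set L := log2 _ => hp hl hq L1 x0.
have div_le (a b : R) : 0 <= a -> 1 <= b -> a / b <= a.
  by move=> a0 b1; rewrite ler_pdivrMr ?ler_peMr // (lt_le_trans ltr01).
have hp' : p%:R <= 43 * x.
  have : 16 * x / L ^+ 3 <= 16 * x by rewrite div_le ?exprn_ege1 //; lra.
  by move: hp; lra.
have hxL : 106 * (x / L) <= 106 * x by rewrite ler_pM2l ?div_le //; lra.
have two_ge1 : 1 <= 2 :> R by lra.
apply: (@le_trans _ _ (2 `^ (p + l)%:R * 2 `^ (106 * (x / L)))).
  rewrite powR_mulrn; last by lra.
  apply: (@le_trans _ _ (2 ^ (p + l) * q)%:R).
    by rewrite ler_nat ramsey_number_book_le.
  by rewrite natrM natrX ler_wpM2l // exprn_ge0.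
rewrite -powRD; last by apply/implyP => _; rewrite pnatr_eq0.
by apply: ler_powR => //; rewrite natrD; lra.
Qed.
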